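(* Let $(X_n)_{n\ge1}$ be a sequence of continuous i.i.d. real random variables such that $x\mapsto\mathbb{P}(X_1>x)$ is regularly varying with index $-\alpha<0$, and let $S_0=0$, $S_n=X_1+\dots+X_n$. Then for every $\varepsilon\in(0,1)$ and $t\in[0,1]$, $$\lim_{s\to\infty}\mathbb{P}\left(\frac{U_s}{U_s+O_s}\le t\ \Big|\ S_{N_s-1}\le s(1-\varepsilon)\right)=t^{\alpha}.$$ If $\mathbb{P}(X_1<0)>0$ then this limit relation is true for all $\varepsilon>0$ (and all $t\in[0,1]$).
   Context: For $s>0$: $N_s=\inf\{n>0:S_n>s\}$, the overshoot is $O_s=S_{N_s}-s$ and the undershoot is $U_s=s-S_{N_s-1}$. Events involving $N_s,O_s,U_s$ are understood to be contained in $\{N_s<\infty\}$. A function $h:\mathbb{R}^+\to\mathbb{R}^+$ is regularly varying with index (exponent) $\gamma$ if $\lim_{t\to\infty}h(xt)/h(t)=x^{\gamma}$ for every $x>0$. A random variable is continuous if it has an absolutely continuous distribution (a density). *)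

(* Defs.v *)
From HB Require Import structures.
From mathcomp Require Import all_boot all_order all_algebra.
From mathcomp Require Import all_classical all_reals all_analysis.

Set Implicit Arguments.
Unset Strict Implicit.
Unset Printing Implicit Defensive.

Import Order.TTheory GRing.Theory Num.Theory.
Import numFieldNormedType.Exports.

Local Open Scope classical_set_scope.
Local Open Scope ring_scope.

(* Functions on R^+ are represented by functions on the whole of R, of which
   only the restriction to ]0, +oo[ matters. *)
Definition regularly_varying (R : realType) (h : R -> R) (gamma : R) : Prop :=
  (forall t : R, 0 < t -> 0 < h t) /\
  (forall x : R, 0 < x -> h (x * t) / h t @[t --> +oo] --> x `^ gamma).

Section random_variables.
Context d (T : measurableType d) (R : realType) (P : probability T R).

Definition mutually_independent (X : nat -> {RV P >-> R}) : Prop :=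
  forall (J : seq nat) (A : nat -> set R), uniq J ->
    (forall i, measurable (A i)) ->
    P (\bigcap_(i in [set` J]) (X i @^-1` A i)) =
    (\prod_(i <- J) P (X i @^-1` A i))%E.

Definition identically_distributed (X : nat -> {RV P >-> R}) : Prop :=
  forall (i j : nat) (A : set R), measurable A ->
    distribution P (X i) A = distribution P (X j) A.

Definition iid (X : nat -> {RV P >-> R}) : Prop :=
  mutually_independent X /\ identically_distributed X.

Definition continuous_rv (X : {RV P >-> R}) : Prop :=
  distribution P X `<< @lebesgue_measure R.

(* P(A | B); only meaningful when P B != 0. *)
Definition cond_prob (A B : set T) : R := fine (P (A `&` B)) / fine (P B).

End random_variables.

Section renewal.
Context d (T : measurableType d) (R : realType) (P : probability T R).
Variable X : nat -> {RV P >-> R}.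
Implicit Types (n : nat) (s : R) (w : T).

(* The steps are indexed from 0: X_1, X_2, ... are X 0, X 1, ... *)
Definition walk n w : R := \sum_(i < n) X i w.

Definition passes s w n : bool := (0 < n)%N && (s < walk n w).

Definition passage_finite s : set T := [set w | exists n, passes s w n].

(* The value 0 stands for N_s = +oo; it is irrelevant since every event below
   is intersected with passage_finite s. *)
Definition passage_index s w : nat :=
  if pselect (exists n, passes s w n) is left ex then ex_minn ex else 0%N.

Definition overshoot s w : R := walk (passage_index s w) w - s.

Definition undershoot s w : R := s - walk (passage_index s w).-1 w.

Definition ratio_event s (t : R) : set T :=
  passage_finite s `&`
  [set w | undershoot s w / (undershoot s w + overshoot s w) <= t].

Definition prepassage_event s (a : R) : set T :=
  passage_finite s `&` [set w | walk (passage_index s w).-1 w <= a].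

End renewal.

(* Main.v *)
(** Decompose {N_s < +oo, S_{N_s - 1} <= a} over the value n + 1 of N_s. Given
    the past (X_1, ..., X_n), the crossing step X_{n+1} is independent of it, so
    conditionally on the past the crossing has probability Fbar(s - S_n), and
    crossing with ratio at most t has probability Fbar((s - S_n) / t), where
    Fbar is the tail of X_1. With a = s (1 - eps) one has s - S_n >= s eps, which
    tends to +oo, hence Fbar((s - S_n) / t) = (t^alpha + o(1)) Fbar(s - S_n)
    uniformly in n and in the past; integrate over the past and sum over n. *)
Require Import Defs.
From HB Require Import structures.
From mathcomp Require Import all_boot all_order all_algebra.
From mathcomp Require Import all_classical all_reals all_analysis.
From mathcomp Require Import measurable_realfun.
Import Order.TTheory GRing.Theory Num.Theory.
Import numFieldNormedType.Exports.
Local Open Scope classical_set_scope.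
Local Open Scope ring_scope.

(** * Independence from a sub-sigma-algebra, and Fubini *)

Section joint_law.
Context {d} {T : measurableType d} {R : realType} {P : probability T R}.
Variables (G : set (set T)) (Y : {RV P >-> R}).
Hypothesis mG : G `<=` measurable.
Hypothesis GI : setI_closed G.
Hypothesis GT : G [set: T].
Hypothesis GY : forall A B, G A -> measurable B ->
  P (A `&` Y @^-1` B) = (P A * P (Y @^-1` B))%E.

Let TG := g_sigma_algebraType G.

(** With [B] fixed, both sides are finite measures in [A] that agree on [G], a pi-system containing
    the whole space, hence on the sigma-algebra it generates. *)
Lemma g_sigma_algebra_indep A B : <<s G >> A -> measurable B ->
  P (A `&` Y @^-1` B) = (P A * P (Y @^-1` B))%E.
Proof.
move=> sA mB.
have mYB : measurable (Y @^-1` B) by exact: measurable_funPTI.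
have p0 : 0 <= fine (P (Y @^-1` B)) by rewrite fine_ge0.
pose m1 := mrestr P mYB.
pose m2 := mscale (NngNum p0) P.
have := @g_sigma_algebra_measure_unique _ _ _ G mG (fun=> setT) (fun=> GT) _ m1 m2 GI.
rewrite bigcup_const// => /(_ erefl) H.
have {H} := H _ _ A sA.
rewrite /m1 /m2 /mrestr /mscale /= /mscale /= fineK ?fin_num_measure// muleC; apply.
  by move=> C GC; rewrite muleC /mrestr GY.
by move=> _; rewrite -ge0_fin_numE// fin_num_measure.
Qed.

(* The identity, seen as a random variable whose distribution is the restriction
   of P to the sub-sigma-algebra generated by G. *)
Definition coarsen : T -> TG := id.

Let measurable_coarsen : measurable_fun [set: T] coarsen.
Proof.
move=> _ A sA; rewrite setTI.
exact: (smallest_sub (@sigma_algebra_measurable _ T) mG).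
Qed.

HB.instance Definition _ := isMeasurableFun.Build _ _ _ _ coarsen measurable_coarsen.

Definition graph_rv (w : T) : TG * R := (coarsen w, Y w).

Let measurable_graph_rv : measurable_fun [set: T] graph_rv.
Proof. by apply: measurable_fun_pair. Qed.

HB.instance Definition _ := isMeasurableFun.Build _ _ _ _ graph_rv measurable_graph_rv.

(** By independence the law of [graph_rv] has product form on rectangles, so it is the product
    measure, whose value at [C] is an integral of sections. *)
Lemma joint_law (C : set (TG * R)) : measurable C ->
  P (graph_rv @^-1` C) =
  (\int[distribution P coarsen]_w distribution P Y (xsection C w))%E.
Proof.
move=> mC.
rewrite -[LHS]/(distribution P graph_rv C).
have <- := @product_measure_unique _ _ _ _ _ (distribution P coarsen) (distribution P Y)
  (distribution P graph_rv) _ _ mC; first by [].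
move=> A B sA mB.
rewrite /distribution /pushforward /=.
exact: g_sigma_algebra_indep.
Qed.

Lemma measurable_graph (C : set (TG * R)) :
  measurable C -> measurable (graph_rv @^-1` C).
Proof. by move=> mC; rewrite -[X in measurable X]setTI; exact: measurable_graph_rv. Qed.

(** A comparison valid for each fixed past is integrated over the past. Two coefficients are kept so
    that no ratio of probabilities has to be formed. *)
Lemma joint_law_le (k1 k2 : R) (C1 C2 : set (TG * R)) : 0 <= k1 -> 0 <= k2 ->
  measurable C1 -> measurable C2 ->
  (forall w, (k1%:E * distribution P Y (xsection C1 w) <=
              k2%:E * distribution P Y (xsection C2 w))%E) ->
  (k1%:E * P (graph_rv @^-1` C1) <= k2%:E * P (graph_rv @^-1` C2))%E.
Proof.
move=> k10 k20 mC1 mC2 h.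
have mx1 := measurable_fun_xsection (distribution P Y) mC1.
have mx2 := measurable_fun_xsection (distribution P Y) mC2.
rewrite !joint_law// -!ge0_integralZl//=.
apply: ge0_le_integral => //=.
- by move=> w _; rewrite mule_ge0.
- exact: measurable_funeM.
- exact: measurable_funeM.
Qed.

End joint_law.

(** * The past of the walk and its independence of the next step *)

Section random_walk.
Context {d} {T : measurableType d} {R : realType} {P : probability T R}.
Variable X : nat -> {RV P >-> R}.

(** A pi-system generating the sigma-algebra of the first [n] steps, on which independence can be
    read off from products. *)
Definition cylinders n : set (set T) :=
  [set \bigcap_(i < n) (X i @^-1` A i) | A in [set A | forall i, measurable (A i)]].

Lemma cylinders_measurable n : cylinders n `<=` measurable.
Proof.
move=> _ [A mA <-]; apply: bigcap_measurableType => i _; exact: measurable_funPTI.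
Qed.

Lemma cylindersI n : setI_closed (cylinders n).
Proof.
move=> _ _ [A mA <-] [B mB <-]; exists (fun i => A i `&` B i).
  by move=> i; exact: measurableI.
by rewrite -bigcapI.
Qed.

Lemma cylindersT n : cylinders n [set: T].
Proof.
by exists (fun=> setT) => //; apply/seteqP; split => // w _ i _.
Qed.

Lemma probability_cylinder (hX : mutually_independent X) n (A : nat -> set R) :
  (forall i, measurable (A i)) ->
  P (\bigcap_(i < n) (X i @^-1` A i)) = (\prod_(i < n) P (X i @^-1` A i))%E.
Proof.
move=> mA; rewrite -[RHS](big_mkord xpredT (fun i => P (X i @^-1` A i))).
rewrite -hX ?iota_uniq//; suff -> : [set` index_iota 0 n] = `I_n by [].
by apply/seteqP; split => i /=; rewrite mem_index_iota.
Qed.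

Lemma cylinders_indep (hX : mutually_independent X) n A B :
  cylinders n A -> measurable B ->
  P (A `&` X n @^-1` B) = (P A * P (X n @^-1` B))%E.
Proof.
move=> [{}A mA <-] mB.
(* Putting [B] at coordinate [n] turns the left side into a cylinder on [n + 1] steps, to which the
   product formula applies. *)
pose A' i := if (i < n)%N then A i else B.
have mA' i : measurable (A' i) by rewrite /A'; case: ifP.
have AA' i : (i < n)%N -> A i = A' i by rewrite /A' => ->.
have {2}-> : B = A' n by rewrite /A' ltnn.
have -> : \bigcap_(i < n) (X i @^-1` A i) = \bigcap_(i < n) (X i @^-1` A' i).
  by apply: eq_bigcapr => i /= /AA' ->.
have -> : X n @^-1` B = X n @^-1` A' n by rewrite /A' ltnn.
have <- : \bigcap_(i < n.+1) (X i @^-1` A' i) =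
    \bigcap_(i < n) (X i @^-1` A' i) `&` X n @^-1` A' n.
  by rewrite !bigcap_mkord big_ord_recr.
by rewrite !probability_cylinder// big_ord_recr.
Qed.

Lemma measurable_coord n i : (i < n)%N ->
  measurable_fun setT (X i : g_sigma_algebraType (cylinders n) -> R).
Proof.
move=> ni _ B mB; rewrite setTI; apply: sub_sigma_algebra.
exists (fun j => if j == i then B else setT) => [j|]; first by case: ifP.
apply/seteqP; split => w /=; first by move=> /(_ i ni) /=; rewrite eqxx.
by move=> XB j _ /=; case: eqP => [->|].
Qed.

Lemma measurable_walk n k : (k <= n)%N ->
  measurable_fun setT (walk X k : g_sigma_algebraType (cylinders n) -> R).
Proof.
move=> kn.
apply: (@measurable_sum _ (g_sigma_algebraType (cylinders n)) R _ 'I_k _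
  (fun i => X i : g_sigma_algebraType (cylinders n) -> R)) => i.
apply: measurable_coord; exact: leq_trans kn.
Qed.

(** * Decomposition of the crossing according to the passage index *)

Lemma walkS n w : walk X n.+1 w = walk X n w + X n w.
Proof. by rewrite /walk big_ord_recr. Qed.

(** What the first [n] steps decide of the event that the passage index is [n + 1] and the walk just
    before is at most [a]. Index 0 is left out, as in [passes]. *)
Definition low_past s a n : set T :=
  \bigcap_(k in [set k | (0 < k <= n)%N]) [set w | walk X k w <= s] `&`
  [set w | walk X n w <= a].

(* Crossing of s at step n + 1 with undershoot at most t times the step; the
   condition of low_past on walk n w is S_{N_s - 1} <= a. *)
Definition jump s a t n : set T :=
  low_past s a n `&`
  [set w | s - walk X n w < X n w /\ s - walk X n w <= t * X n w].

Lemma passage_indexP s n w :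
  (passage_finite X s w /\ passage_index X s w = n.+1) <->
  (forall k, (0 < k <= n)%N -> walk X k w <= s) /\ s < walk X n.+1 w.
Proof.
rewrite /passage_finite /passage_index /=; split.
  move=> [ex]; case: pselect => // ex'; case: ex_minnP => m pm mm mn; subst m.
  split; last by case/andP: pm.
  move=> k /andP[k0 kn]; rewrite leNgt; apply/negP => sk.
  by have := mm k; rewrite /passes k0 sk => /(_ isT); rewrite ltnNge kn.
move=> [le_s gt_s].
have ex : exists n, passes X s w n by exists n.+1; rewrite /passes.
split=> //; case: pselect => // ex'; case: ex_minnP => m /andP[m0 sm] mm.
apply/eqP; rewrite eqn_leq mm /passes//=; rewrite ltnNge.
by apply/negP => mn; move: sm; rewrite ltNge le_s// m0.
Qed.

Lemma passage_finite_index s w : passage_finite X s w ->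
  exists n, passage_index X s w = n.+1.
Proof.
rewrite /passage_finite /passage_index /= => ex.
case: pselect => // ex'; case: ex_minnP => -[|m] // _ _; by exists m.
Qed.

Lemma jump_passage s a t n w : jump s a t n w ->
  passage_finite X s w /\ passage_index X s w = n.+1.
Proof.
move=> [[le_s _] [lt_X _]]; apply/passage_indexP; split=> //.
by rewrite walkS -ltrBlDl.
Qed.

Lemma trivIset_jump s a t : trivIset [set: nat] (jump s a t).
Proof.
move=> m n _ _ [w [/jump_passage[_ wm] /jump_passage[_]]].
by rewrite wm => -[].
Qed.

(** At [t = 1] the second inequality of [jump] follows from the first, so numerator and denominator
    belong to one family of sets. *)
Lemma prepassage_jump s a : prepassage_event X s a = \bigcup_n jump s a 1 n.
Proof.
apply/seteqP; split => w.
  move=> [fw /=]; have [n nw] := passage_finite_index _ _ fw.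
  rewrite nw /= => le_a; exists n => //.
  have [le_s gt_s] := (passage_indexP _ _ _).1 (conj fw nw).
  have lt_X : s - walk X n w < X n w by rewrite ltrBlDl -walkS.
  by split; [split | split; rewrite ?mul1r //; exact: ltW].
move=> [n _ jw]; have [fw nw] := jump_passage _ _ _ _ _ jw.
by split=> //=; rewrite nw; case: jw => -[].
Qed.

(** At the crossing, undershoot plus overshoot is the step [X n w]. It is positive, since it exceeds
    [s - walk X n w >= s - a > 0], so the quotient can be cleared. *)
Lemma ratio_jump s a t : a < s ->
  ratio_event X s t `&` prepassage_event X s a = \bigcup_n jump s a t n.
Proof.
move=> a_s.
have E n w : passage_index X s w = n.+1 -> 0 < X n w ->
    (undershoot X s w / (undershoot X s w + overshoot X s w) <= t) =
    (s - walk X n w <= t * X n w).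
  rewrite /undershoot /overshoot => -> /= X0.
  rewrite walkS.
  by rewrite [X in _ / X]addrA subrKA [X in _ / X]addrC addKr ler_pdivrMr.
apply/seteqP; split => w.
  move=> [[_ /= le_t]]; rewrite prepassage_jump => -[n _ jw].
  have [fw nw] := jump_passage _ _ _ _ _ jw.
  case: jw => -[le_s le_a] [lt_X _]; exists n => //.
  have X0 : 0 < X n w.
    by rewrite (le_lt_trans _ lt_X)// subr_ge0 (le_trans le_a)// ltW.
  by split; [split|split => //; rewrite -(E _ _ nw X0)].
move=> [n _ jw].
have [fw nw] := jump_passage _ _ _ _ _ jw.
case: jw => -[le_s le_a] [lt_X le_tX].
have X0 : 0 < X n w.
  by rewrite (le_lt_trans _ lt_X)// subr_ge0 (le_trans le_a)// ltW.
split; first by split=> //=; rewrite (E n).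
by split=> //=; rewrite nw.
Qed.

(** * Jump probabilities in terms of the tail of one step *)

Section jump_tail.
Hypothesis hiid : iid X.
Hypothesis hcont : forall n, continuous_rv (X n).

Let F (u : R) : R := fine (ccdf (X 0%N) u).

Lemma distribution_set1 n (x : R) : distribution P (X n) [set x] = 0%E.
Proof.
apply: (hcont n [set x]) => // A mA Ax.
apply/eqP; rewrite -measure_le0 -(lebesgue_measure_set1 x).
by apply: le_measure => //; rewrite inE.
Qed.

(** [A] is squeezed between the open and the closed half-line, which differ by a point of mass zero.
    Absolute continuity enters here, and strict and large inequalities need not be told apart. *)
Lemma distribution_tail n (A : set R) u :
  measurable A -> `]u, +oo[ `<=` A -> A `<=` `[u, +oo[ ->
  distribution P (X n) A = (F u)%:E.
Proof.
move=> mA uA Au.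
have -> : (F u)%:E = distribution P (X n) `]u, +oo[.
  rewrite /F /ccdf fineK ?fin_num_measure//.
  exact: hiid.2.
apply/eqP; rewrite eq_le; apply/andP; split; last first.
  by apply: le_measure => //; rewrite inE.
rewrite -(@measureU0 _ _ _ (distribution P (X n)) `]u, +oo[ [set u])//; last first.
  exact: distribution_set1.
rewrite setUC setU1itv//.
by apply: le_measure => //; rewrite inE.
Qed.

Let TG n := g_sigma_algebraType (cylinders n).

(** [jump] as a set of pairs (past, next step): its preimage under [graph_rv] is [jump]. The first
    factor carries only the sigma-algebra of the past. *)
Definition jump_graph s a t n : set (TG n * R) :=
  [set p | low_past s a n p.1] `&`
  [set p | s - walk X n p.1 < p.2 /\ s - walk X n p.1 <= t * p.2].

Lemma measurable_jump_graph s a t n : measurable (jump_graph s a t n).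
Proof.
have mle k c : (k <= n)%N ->
    measurable ([set w | walk X k w <= c] : set (TG n)).
  move=> kn; rewrite -[X in measurable X]setTI.
  by apply: measurable_fun_le => //; exact: measurable_walk.
have mS : measurable_fun setT (fun p : TG n * R => s - walk X n p.1).
  apply: measurable_funB => //.
  by apply: (measurableT_comp (measurable_walk _ _ (leqnn n))).
apply: measurableI.
  rewrite -[X in measurable X]setTI.
  apply: (@measurable_fst _ _ (TG n) R measurableT (low_past s a n)).
  apply: measurableI; last exact: mle.
  by apply: bigcap_measurableType => k /andP[_ kn]; exact: mle.
apply: (@measurableI _ _ [set p : TG n * R | s - walk X n p.1 < p.2]
  [set p : TG n * R | s - walk X n p.1 <= t * p.2]).
  rewrite [X in measurable X](_ : _ = ~` [set p | p.2 <= s - walk X n p.1]).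
    apply: measurableC; rewrite -[X in measurable X]setTI.
    by apply: measurable_fun_le.
  by apply/seteqP; split => p /=; rewrite ltNge => /negP.
rewrite -[X in measurable X]setTI.
by apply: measurable_fun_le => //; exact: measurable_funM.
Qed.

Lemma measurable_jump s a t n : measurable (jump s a t n).
Proof.
exact: (@measurable_graph _ _ _ P _ (X n) (@cylinders_measurable n) _
  (measurable_jump_graph s a t n)).
Qed.

(** Let [u = s - walk X n w > 0]. As [t <= 1], [u <= u / t], so the ratio condition governs and the
    section is a half-line from [u / t], up to its endpoint. *)
Lemma jump_tail s a t n (w : T) : a < s -> 0 < t <= 1 -> low_past s a n w ->
  distribution P (X n) (xsection (jump_graph s a t n) w) =
  (F ((s - walk X n w) / t))%:E.
Proof.
move=> as_ /andP[t0 t1] pw.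
have d0 : 0 < s - walk X n w by rewrite subr_gt0 (le_lt_trans pw.2).
have dt : s - walk X n w <= (s - walk X n w) / t.
  by rewrite ler_pdivlMr// ler_piMr// ltW.
apply: distribution_tail.
- by apply: measurable_xsection; exact: measurable_jump_graph.
- move=> x /=; rewrite in_itv/= andbT => hx; rewrite /xsection /= inE; split => //=.
  split; first exact: le_lt_trans hx.
  by move: hx; rewrite ltr_pdivrMr// mulrC => /ltW.
- move=> x /=; rewrite /xsection /= inE => -[_ /= [_ h]].
  by rewrite in_itv/= andbT ler_pdivrMr// mulrC.
Qed.

(** On [low_past] the sections have tail probabilities with [u >= s - a], where the assumed
    comparison applies; off it both sections are empty. *)
Lemma jump_le s a t1 t2 (k1 k2 : R) n : a < s -> 0 < t1 <= 1 -> 0 < t2 <= 1 ->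
  0 <= k1 -> 0 <= k2 ->
  (forall u, s - a <= u -> k1 * F (u / t1) <= k2 * F (u / t2)) ->
  (k1%:E * P (jump s a t1 n) <= k2%:E * P (jump s a t2 n))%E.
Proof.
move=> as_ t1_01 t2_01 k10 k20 h.
apply: (@joint_law_le _ _ _ P _ (X n) (@cylinders_measurable n) (@cylindersI n)
  (cylindersT n) (fun A B => @cylinders_indep hiid.1 n A B) k1 k2
  (jump_graph s a t1 n) (jump_graph s a t2 n)) => //.
- exact: measurable_jump_graph.
- exact: measurable_jump_graph.
move=> w; have [pw|npw] := pselect (low_past s a n w).
  by rewrite !jump_tail// -!EFinM lee_fin; apply: h; rewrite lerD2l lerN2; exact: pw.2.
have x0 t : xsection (jump_graph s a t n) w = set0.
  by rewrite -subset0 => x; rewrite /xsection /= inE => -[].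
by rewrite !x0 !measure0 !mule0.
Qed.

Lemma bigcup_jump_le s a t1 t2 (k1 k2 : R) : a < s -> 0 < t1 <= 1 -> 0 < t2 <= 1 ->
  0 <= k1 -> 0 <= k2 ->
  (forall u, s - a <= u -> k1 * F (u / t1) <= k2 * F (u / t2)) ->
  (k1%:E * P (\bigcup_n jump s a t1 n) <= k2%:E * P (\bigcup_n jump s a t2 n))%E.
Proof.
move=> as_ t1_01 t2_01 k10 k20 h.
rewrite !measure_semi_bigcup//; try exact: trivIset_jump; try exact: measurable_jump;
  try (by apply: bigcup_measurable => n _; exact: measurable_jump).
rewrite -!nneseriesZl//; apply: lee_nneseries => n *.
  by rewrite mule_ge0.
exact: jump_le.
Qed.

End jump_tail.

(** An explicit scenario: [n] steps in []b, c[] keep the walk nonpositive and bring it into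
    [[b *+ n, c *+ n]], below [a]; one step larger than [s - b *+ n] then crosses [s]. *)
Lemma bigcup_jump_gt0 (hX : mutually_independent X) (s a b c : R) n :
  (forall i, (i < n)%N -> 0 < P (X i @^-1` `]b, c[))%E ->
  (0 < P (X n @^-1` `](s - b *+ n)%R, +oo[))%E ->
  0 <= s -> b < 0 -> c <= 0 -> c *+ n <= a ->
  (0 < P (\bigcup_n jump s a 1 n))%E.
Proof.
move=> hI hJ s0 b0 c0 na.
pose A i := if (i < n)%N then `]b, c[%classic else `]s - b *+ n, +oo[%classic : set R.
have mA i : measurable (A i) by rewrite /A; case: ifP.
have walk_bounds w k : (k <= n)%N -> (forall i, (i < n)%N -> b < X i w < c) ->
    b *+ k <= walk X k w <= c *+ k.
  move=> kn wX; rewrite /walk -[k in b *+ k]card_ord -[k in c *+ k]card_ord.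
  rewrite -!sumr_const.
  by apply/andP; split; apply: ler_sum => i _;
    have /andP[? ?] := wX i (leq_trans (ltn_ord i) kn); exact: ltW.
apply: (@lt_le_trans _ _ (P (\bigcap_(i < n.+1) (X i @^-1` A i)))).
  rewrite probability_cylinder//.
  elim/big_ind : _ => [|x y x0 y0|i _]; [by rewrite lte01|exact: mule_gt0|].
  rewrite /A; case: ifP => [|ni]; first exact: hI.
  have -> // : i = n :> nat.
  by apply/eqP; rewrite eqn_leq -ltnS ltn_ord/= leqNgt ni.
apply: le_measure.
- by rewrite inE; exact: (@cylinders_measurable n.+1 _ (ex_intro2 _ _ A mA erefl)).
- rewrite inE; apply: bigcup_measurable => k _; exact: measurable_jump.
move=> w wA; exists n => //.
have wX i : (i < n)%N -> b < X i w < c.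
  by move=> ni; have := wA i (ltnW ni); rewrite /= /A ni /= in_itv.
have Xn : s - b *+ n < X n w.
  by have := wA n (ltnSn n); rewrite /= /A ltnn /= in_itv/= andbT.
have sX : s - walk X n w < X n w.
  rewrite (le_lt_trans _ Xn)// lerD2l lerN2.
  by have /andP[] := walk_bounds w n (leqnn n) wX.
split; last by rewrite /= mul1r; split => //; exact: ltW.
split; last first.
  rewrite /= (le_trans _ na)//.
  by have /andP[] := walk_bounds w n (leqnn n) wX.
move=> k /andP[_ kn] /=.
have /andP[_ /le_trans] := walk_bounds w k kn wX; apply.
by rewrite (le_trans _ s0)// mulrn_wle0.
Qed.

End random_walk.

(** * The limit, given conditioning events of positive probability *)

Lemma cvg_cond_prob {d} {T : measurableType d} {R : realType}
    {P : probability T R} (X : nat -> {RV P >-> R}) (alpha eps t : R) :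
  iid X -> (forall n, continuous_rv (X n)) -> 0 < alpha ->
  regularly_varying (fun x : R => fine (ccdf (X 0%N) x)) (- alpha) ->
  0 < eps -> 0 <= t <= 1 ->
  (\forall s \near +oo, (0 < P (\bigcup_n jump X s (s * (1 - eps))%R 1%R n))%E) ->
  cond_prob P (ratio_event X s t) (prepassage_event X s (s * (1 - eps)))
    @[s --> +oo] --> t `^ alpha.
Proof.
move=> hiid hcont alpha0 [F0 hF] eps0 /andP[t0 t1] den0.
set F := fun x : R => fine (ccdf (X 0%N) x).
have lt_s s : 0 < s -> s * (1 - eps) < s.
  by move=> s0; rewrite mulrBr mulr1 ltrBlDr ltrDl mulr_gt0.
apply/cvgrPdist_le => e e0.
(* For [t = 0], where [t^-1] is of no use, the numerator is empty: it would force a positive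
   undershoot to be at most 0. *)
move: t0; rewrite le_eqVlt => /predU1P[<-|t0].
  rewrite powR0 ?gt_eqF//.
  near=> s.
  have s0 : 0 < s by near: s; exact: nbhs_pinfty_gt.
  rewrite /cond_prob ratio_jump ?lt_s//.
  rewrite bigcup0 ?measure0 ?mul0r ?subrr ?normr0 ?ltW// => n _.
  rewrite -subset0 => w [[_ /= le_a] [_ /=]].
  by rewrite mul0r subr_le0 leNgt (le_lt_trans le_a)// lt_s.
(* Regular variation at the factor [t^-1] gives the limit [(t^-1)]^ (- alpha) = t [^ alpha]. *)
have tV0 : 0 < t^-1 by rewrite invr_gt0.
have {hF} := hF _ tV0.
rewrite -powR_inv1 ?ltW// -powRrM mulN1r opprK powR_inv1 ?ltW//.
move=> /cvgrPdist_le /(_ e e0) [M [_ hM]].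
near=> s.
have s0 : 0 < s by near: s; exact: nbhs_pinfty_gt.
(* Every relevant [u] is at least [s * eps], so this single threshold makes the tail estimate
   uniform in the past and in [n]. *)
have sM : M < s * eps.
  by rewrite -ltr_pdivrMr//; near: s; apply: nbhs_pinfty_gt; exact: num_real.
have sd0 : 0 < s * eps by rewrite mulr_gt0.
have hD : (0 < P (\bigcup_n jump X s (s * (1 - eps))%R 1%R n))%E by near: s.
have sE : s - s * (1 - eps) = s * eps.
  by rewrite mulrBr mulr1 opprB addrC subrK.
have bound u : s - s * (1 - eps) <= u ->
    (t `^ alpha - e) * F u <= F (u / t) <= (t `^ alpha + e) * F u.
  rewrite sE => su.
  have Fu0 : 0 < F u by apply: F0; exact: lt_le_trans su.
  have := hM u (lt_le_trans sM su); rewrite distrC ler_distl.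
  by rewrite ler_pdivlMr// ler_pdivrMr// mulrC [t^-1 * u]mulrC.
have t01 : 0 < t <= 1 by rewrite t0.
have t11 : 0 < (1 : R) <= 1 by rewrite ltr01 lexx.
have te0 : 0 <= t `^ alpha + e by rewrite addr_ge0 ?powR_ge0 ?ltW.
have upper := @bigcup_jump_le _ _ _ P X hiid hcont s (s * (1 - eps)) t 1 1
  (t `^ alpha + e) (lt_s _ s0) t01 t11 ler01 te0.
have lower := @bigcup_jump_le _ _ _ P X hiid hcont s (s * (1 - eps)) 1 t
  (Num.max 0 (t `^ alpha - e)) 1 (lt_s _ s0) t11 t01.
rewrite /cond_prob ratio_jump ?lt_s// prepassage_jump.
have mJ t' : measurable (\bigcup_n jump X s (s * (1 - eps)) t' n).
  by apply: bigcup_measurable => n _; exact: measurable_jump.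
move: hD upper lower.
rewrite -(fineK (fin_num_measure P _ (mJ 1))) -(fineK (fin_num_measure P _ (mJ t))).
set D := fine (P _); set N := fine (P _).
rewrite -!EFinM !lee_fin lte_fin => D0 upper lower.
rewrite distrC ler_distl ler_pdivlMr// ler_pdivrMr//.
apply/andP; split.
  apply: (@le_trans _ _ (Num.max 0 (t `^ alpha - e) * D)).
    by apply: ler_wpM2r; [exact: ltW|rewrite le_max lexx orbT].
  rewrite -[leRHS]mul1r; apply: lower => //; first by rewrite le_max lexx.
  move=> u su; rewrite divr1 mul1r.
  rewrite maxr_pMl; last by rewrite /F fine_ge0.
  by rewrite mul0r ge_max fine_ge0//=; have /andP[] := bound u su.
rewrite -[leLHS]mul1r; apply: upper => u su; rewrite divr1 mul1r.
by have /andP[] := bound u su.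
Unshelve. all: by end_near. Qed.

(** The negative half-line is a countable union of bounded intervals away from 0; were all of them
    null, so would be their union. *)
Lemma exists_negative_interval {d} {T : measurableType d}
    {R : realType} {P : probability T R} (Y : {RV P >-> R}) :
  (0 < P [set w | (Y w < 0)%R])%E ->
  exists b c : R, [/\ b < 0, c < 0 & (0 < P (Y @^-1` `]b, c[))%E].
Proof.
move=> hY; apply: contrapT => /forallNP h; move: hY.
have mY m : measurable (Y @^-1` `](- m.+1%:R)%R, (- m.+1%:R^-1)%R[ : set T).
  exact: measurable_funPTI.
have -> : [set w | Y w < 0] = \bigcup_m (Y @^-1` `](- m.+1%:R)%R, (- m.+1%:R^-1)%R[).
  apply/seteqP; split => w /=.
    move=> Y0.
    have NY0 : 0 < - Y w by rewrite oppr_gt0.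
    (* The first term gives [- m.+1%:R < Y w], the second gives [Y w < - m.+1%:R^-1]. *)
    pose m := maxn (Num.truncn (- Y w)) (Num.truncn (- Y w)^-1).
    exists m => //=; rewrite in_itv/= ltrNl ltrNr.
    have lt_m (x : R) : (Num.truncn x <= m)%N -> x < m.+1%:R.
      by move=> xm; rewrite (lt_le_trans (truncnS_gt x))// ler_nat.
    rewrite lt_m ?leq_maxl//=.
    by rewrite -[ltRHS]invrK ltf_pV2 ?posrE ?invr_gt0// lt_m ?leq_maxr.
  move=> [m _ /=]; rewrite in_itv/= => /andP[_ /lt_trans]; apply.
  by rewrite oppr_lt0.
rewrite lt_neqAle => /andP[/negP + _]; apply; apply/eqP/esym.
have mU := bigcup_measurable (fun m (_ : setT m) => mY m).
apply/(@negligibleP _ _ _ P _ mU)/negligible_bigcup => m.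
apply/(@negligibleP _ _ _ P _ (mY m)).
apply/eqP; rewrite -measure_le0 leNgt; apply/negP => hm.
by apply: (h (- m.+1%:R)); exists (- m.+1%:R^-1); rewrite !oppr_lt0.
Qed.

Theorem theorem2p3 (d : measure_display) (T : measurableType d) (R : realType)
    (P : probability T R) (X : nat -> {RV P >-> R}) (alpha : R)
    (hiid : iid X)
    (hcont : forall n : nat, continuous_rv (X n))
    (halpha : 0 < alpha)
    (htail : regularly_varying (fun x : R => fine (ccdf (X 0%N) x)) (- alpha)) :
  (forall eps t : R, 0 < eps < 1 -> 0 <= t <= 1 ->
     cond_prob P (ratio_event X s t) (prepassage_event X s (s * (1 - eps)))
       @[s --> +oo] --> t `^ alpha)
  /\
  ((0 < P [set w | (X 0%N w < 0)%R])%E ->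
   forall eps t : R, 0 < eps -> 0 <= t <= 1 ->
     cond_prob P (ratio_event X s t) (prepassage_event X s (s * (1 - eps)))
       @[s --> +oo] --> t `^ alpha).
Proof.
have eqX n (A : set R) : measurable A -> P (X n @^-1` A) = P (X 0%N @^-1` A).
  exact: hiid.2.
have tail0 n u : 0 < u -> (0 < P (X n @^-1` `]u, +oo[))%E.
  move=> u0; have := htail.1 _ u0; rewrite -lte_fin /ccdf fineK ?fin_num_measure//.
  by rewrite eqX.
split=> [eps t /andP[eps0 eps1] t01|neg eps t eps0 t01];
    apply: cvg_cond_prob => //; near=> s.
  have s0 : 0 < s by near: s; exact: nbhs_pinfty_gt.
  (* For [eps < 1] the start 0 is already below [s * (1 - eps)], so crossing at the first step
     suffices: [n = 0], with arbitrary admissible [b] and [c]. *)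
  apply: (@bigcup_jump_gt0 _ _ _ P X hiid.1 _ _ (- 1) 0 0) => //; rewrite ?mulr0n.
  - by rewrite subr0; exact: tail0.
  - by rewrite mulr_ge0 ?ltW// subr_gt0.
have s0 : 0 < s by near: s; exact: nbhs_pinfty_gt.
have [b [c [b0 c0 hbc]]] := exists_negative_interval _ neg.
(* Enough steps below [c < 0] to descend to [s * (1 - eps)], which may be negative. Here [n] depends
   on [s], which is harmless since only positivity for each [s] is wanted. *)
pose n := (Num.truncn (s * (1 - eps) / c)).+1.
have cn : c *+ n <= s * (1 - eps).
  by rewrite -mulr_natr mulrC -ler_ndivrMr//; exact/ltW/truncnS_gt.
apply: (@bigcup_jump_gt0 _ _ _ P X hiid.1 _ _ b c n) => //; try exact: ltW.
- by move=> i _; rewrite eqX.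
- by apply: tail0; rewrite subr_gt0 (le_lt_trans _ s0)// mulrn_wle0 ?ltW.
Unshelve. all: by end_near. Qed.
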